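(* Let $G$ be a finite undirected graph without multiple edges, possibly with loops. Let $v_1, v_2, \dots, v_k$ be distinct vertices of $G$ such that there is a loop $l_i$ at $v_i$ for each $i = 1, \dots, k$. Put $\mathcal{L} = \{v_1, \dots, v_k\}$ and $G' = G - \{l_1, l_2, \dots, l_k\}$. Then $$\phi(G) = \sum_{X \subseteq \mathcal{L}} (-1)^{|X|}\, \phi(G' - X).$$
   Context: Graphs are finite and undirected, have no multiple edges, and may have at most one loop at each vertex. For a graph $G$ with vertices $u_1,\dots,u_p$, the adjacency matrix $A(G) = [a_{ij}]$ is the $p \times p$ matrix with, for $i\neq j$, $a_{ij}=1$ if $u_i,u_j$ are adjacent and $0$ otherwise, and $a_{ii}=1$ if there is a loop at $u_i$ and $0$ otherwise. $\phi(G) = \phi(G;x) = \det(xI - A(G))$ is the characteristic polynomial of $A(G)$; for the graph with no vertices it equals $1$. $G - \{l_1,\dots,l_k\}$ is $G$ with the loops $l_1,\dots,l_k$ deleted (vertices kept). For a set $X$ of vertices, $G' - X$ is $G'$ with the vertices of $X$ (and all incident edges and loops) deleted. $G$ may have further loops at vertices outside $\mathcal{L}$, which then remain in $G'$. *)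

(* Defs.v *)
From HB Require Import structures.
From mathcomp Require Import all_boot all_order all_algebra.

Set Implicit Arguments.
Unset Strict Implicit.
Unset Printing Implicit Defensive.

Import GRing.Theory.
Local Open Scope ring_scope.

(* [adj] is not required to be irreflexive: [adj x x] means that there is a
   (necessarily unique) loop at [x], so loops are identified with the vertices
   carrying them. *)
Record lgraph := LGraph {
  vertex :> finType;
  adj : rel vertex;
  adj_sym : symmetric adj
}.

Definition has_loop (G : lgraph) (x : G) : bool := adj x x.

Definition del_loops_adj (G : lgraph) (S : {set G}) : rel G :=
  fun x y => adj x y && ~~ ((x == y) && (x \in S)).

Lemma del_loops_adj_sym (G : lgraph) (S : {set G}) :
  symmetric (del_loops_adj S).
Proof.
move=> x y; rewrite /del_loops_adj adj_sym [y == x]eq_sym.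
by case: eqP => [->|].
Qed.

(* Deletes the loops at the vertices of [S]; the vertex set is unchanged. *)
Definition del_loops (G : lgraph) (S : {set G}) : lgraph :=
  LGraph (del_loops_adj_sym S).

Definition del_vertices_adj (G : lgraph) (X : {set G}) :
    rel {x : G | x \notin X} :=
  fun x y => adj (val x) (val y).

Lemma del_vertices_adj_sym (G : lgraph) (X : {set G}) :
  symmetric (@del_vertices_adj G X).
Proof. by move=> x y; exact: adj_sym. Qed.

Definition del_vertices (G : lgraph) (X : {set G}) : lgraph :=
  LGraph (@del_vertices_adj_sym G X).

(* The vertices are ordered as in [enum G]. *)
Definition adjmx (G : lgraph) : 'M[int]_#|G| :=
  \matrix_(i, j) (adj (enum_val i) (enum_val j))%:R.

(* [char_poly A] is [\det ('X%:M - A)], and is [1] for the 0 x 0 matrix. *)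
Definition phi (G : lgraph) : {poly int} := char_poly (adjmx G).

(* Main.v *)
Require Import Defs.
From mathcomp Require Import all_boot all_order all_algebra.
From mathcomp Require Import perm.

Set Implicit Arguments.
Unset Strict Implicit.
Unset Printing Implicit Defensive.

Import GRing.Theory.
Local Open Scope ring_scope.

(** Deleting loops subtracts a diagonal 0-1 matrix from the adjacency matrix,
    so [x I - A(G)] is [x I - A(G')] minus the indicator of [L] on the diagonal.
    The determinant of [M + diag d] is, by multilinearity in the rows, the sum
    over vertex sets [X] of the determinants of [M] with the rows in [X]
    replaced by those of [diag d]; listing [X] first makes such a matrix block
    triangular, and its determinant is [\prod_(x in X) d x] times the principal
    minor of [M] on the complement of [X]. *)

(** Indexing by [T] itself makes the minor left after removing [X] again an [fdet], over a subtype
    of [T], with no renumbering. *)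
Definition fdet (R : comNzRingType) (T : finType) (M : T -> T -> R) : R :=
  \det (\matrix_(i < #|T|, j < #|T|) M (enum_val i) (enum_val j)).

Lemma eq_fdet (R : comNzRingType) (T : finType) (M N : T -> T -> R) :
  (forall x y, M x y = N x y) -> fdet M = fdet N.
Proof. by move=> eqMN; congr (\det _); apply/matrixP => i j; rewrite !mxE. Qed.

(** Two enumerations of [T] differ by one permutation, applied to both rows and columns, so its sign
    occurs twice and cancels. *)
Lemma fdet_bij (R : comNzRingType) (T : finType) (M : T -> T -> R) (n : nat)
    (f : 'I_n -> T) :
  bijective f -> fdet M = \det (\matrix_(i, j) M (f i) (f j)).
Proof.
move=> bij_f; have eqTn : #|T| = n by rewrite -(bij_eq_card bij_f) card_ord.
rewrite /fdet; case: n / eqTn f bij_f => f [g fK gK].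
have inj_s : injective (fun i => enum_rank (f i)).
  by move=> i j /enum_rank_inj /(can_inj fK).
pose s := perm inj_s; set A := \matrix_(i, j) _.
have -> : \matrix_(i, j) M (f i) (f j) = row_perm s (col_perm s A).
  by apply/matrixP => i j; rewrite !mxE !permE !enum_rankK.
rewrite row_permE col_permE !det_mulmx !det_perm mulrCA -signr_addb.
by rewrite odd_permV addbb mulr1.
Qed.

Lemma fdetD (R : comNzRingType) (T : finType) (M N : T -> T -> R) :
  fdet (fun x y => M x y + N x y) =
  \sum_(X : {set T}) fdet (fun x y => if x \in X then N x y else M x y).
Proof.
(* Distributing a product over rows yields sets of row indices; this bijection turns them into sets
   of elements of [T]. *)
have bij_pre : bijective (fun X : {set T} => enum_val @^-1: X : {set 'I_#|T|}).
  exists (fun J : {set 'I_#|T|} => enum_rank @^-1: J) => X;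
    by apply/setP => x; rewrite !inE ?enum_rankK ?enum_valK.
rewrite [LHS](eq_fdet (N := fun x y => N x y + M x y)); last first.
  by move=> x y; rewrite addrC.
(* With both sides read as Leibniz sums, the permutation sum is moved outermost on the right; the
   product over rows is then distributed for each fixed [s]. *)
rewrite exchange_big /=; apply: eq_bigr => s _.
rewrite -mulr_sumr; congr (_ * _).
under eq_bigr do rewrite mxE.
rewrite bigA_distr (reindex _ (onW_bij _ bij_pre)) /=.
by apply: eq_bigr => X _; apply: eq_bigr => i _; rewrite mxE inE.
Qed.

Lemma fdet_diag_rows (R : comNzRingType) (T : finType) (M : T -> T -> R)
    (d : T -> R) (X : {set T}) :
  fdet (fun x y => if x \in X then d x *+ (x == y) else M x y) =
  (\prod_(x in X) d x) *
    fdet (fun x y : {x : T | x \notin X} => M (val x) (val y)).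
Proof.
pose S := {x : T | x \notin X}.
pose f (i : 'I_(#|X| + #|{: S}|)) : T :=
  match split i with inl j => enum_val j | inr j => val (enum_val j) end.
have fl j : f (lshift _ j) = enum_val j.
  by rewrite /f (unsplitK (inl _ j)).
have fr j : f (rshift _ j) = val (enum_val j).
  by rewrite /f (unsplitK (inr _ j)).
have neq_lr (i : 'I_#|X|) (j : 'I_#|{: S}|) :
    enum_val i == val (enum_val j) = false.
  by apply: contraNF (valP (enum_val j)) => /eqP <-; apply: enum_valP.
have inj_f : injective f.
  move=> i j; case: (split_ordP i) => i' ->; case: (split_ordP j) => j' ->;
    rewrite ?fl ?fr.
  - by move/enum_val_inj->.
  - by move/eqP; rewrite neq_lr.
  - by move/eqP; rewrite eq_sym neq_lr.
  - by move/val_inj/enum_val_inj->.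
have bij_f : bijective f.
  apply: inj_card_bij => //.
  by rewrite card_ord card_sig -(cardC (mem X)) leq_add2l.
rewrite (fdet_bij _ bij_f) -[X in \det X]submxK.
(* Rows in [X] vanish off the diagonal, hence on every column outside [X]. The lower left block is
   arbitrary. *)
have -> : ursubmx (\matrix_(i, j) if f i \in X then d (f i) *+ (f i == f j)
                                  else M (f i) (f j)) = 0.
  by apply/matrixP => i j; rewrite !mxE fl fr enum_valP neq_lr.
rewrite det_lblock; congr (_ * _); last first.
  congr (\det _); apply/matrixP => i j.
  by rewrite !mxE !fr (negPf (valP (enum_val i))).
rewrite big_enum_val.
transitivity (\det (diag_mx (\row_(j < #|X|) d (enum_val j)))); last first.
  by rewrite det_diag; apply: eq_bigr => i _; rewrite mxE.
congr (\det _); apply/matrixP => i j.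
by rewrite !mxE !fl enum_valP (inj_eq enum_val_inj).
Qed.

Lemma fdet_add_diag (R : comNzRingType) (T : finType) (M : T -> T -> R)
    (d : T -> R) :
  fdet (fun x y => M x y + d x *+ (x == y)) =
  \sum_(X : {set T}) (\prod_(x in X) d x) *
    fdet (fun x y : {x : T | x \notin X} => M (val x) (val y)).
Proof. by rewrite fdetD; apply: eq_bigr => X _; rewrite fdet_diag_rows. Qed.

Lemma phi_fdet (G : lgraph) :
  phi G = fdet (fun x y : G => 'X *+ (x == y) - (adj x y)%:R).
Proof.
congr (\det _); apply/matrixP => i j.
by rewrite !mxE (inj_eq enum_val_inj) rmorph_nat.
Qed.

(** One element of [X] outside [L] kills the product; this is what cuts the sum over all vertex sets
    down to subsets of [L]. *)
Lemma prod_opp_indicator (R : comNzRingType) (T : finType) (L X : {set T}) :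
  \prod_(x in X) - (x \in L)%:R = (-1) ^+ #|X| *+ (X \subset L) :> R.
Proof.
case: (boolP (X \subset L)) => [/subsetP sXL | /subsetPn[x Xx Lx]].
  by rewrite -prodr_const; apply: eq_bigr => x /sXL ->.
by rewrite (bigD1 x) //= (negPf Lx) oppr0 mul0r.
Qed.

Theorem theorem3p1 (G : lgraph) (k : nat) (v : 'I_k -> G)
    (v_inj : injective v) (v_loop : forall i : 'I_k, has_loop (v i)) :
  let L : {set G} := [set v i | i : 'I_k] in
  let G' : lgraph := del_loops L in
  phi G = \sum_(X : {set G'} | X \subset L)
            (-1) ^+ #|X| * phi (del_vertices X).
Proof.
move=> L G'.
have loopL x : x \in L -> adj x x by case/imsetP => i _ ->; apply: v_loop.
pose M (x y : G) : {poly int} := 'X *+ (x == y) - (@adj G' x y)%:R.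
rewrite phi_fdet (eq_fdet (N := fun x y => M x y - (x \in L)%:R *+ (x == y))).
  rewrite (eq_fdet (N := fun x y => M x y + (- (x \in L)%:R) *+ (x == y)));
    last by move=> x y; rewrite mulNrn.
  rewrite fdet_add_diag [RHS]big_mkcond; apply: eq_bigr => X _.
  rewrite prod_opp_indicator; case: ifP => _; last by rewrite mul0r.
  (* Equality in the subtype is equality of underlying vertices, so the minor of [M] is already the
     matrix of [del_vertices X]. *)
  by rewrite phi_fdet.
(* The matrices of [G] and [G'] differ only on the diagonal at [L], where [loopL] supplies the entry
   1 that [G'] has lost. *)
move=> x y; rewrite /M /= /del_loops_adj.
case: eqP => [<-|_] /=; last by rewrite andbT subr0.
by case: (boolP (x \in L)) => [/loopL -> | _]; rewrite ?andbT ?subr0.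
Qed.
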